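(* Let $p$ be a prime and let $G=D_{2p}$ or $G=D_{2p^2}$. Then $E(\mathcal{B}(G))<LE(\mathcal{B}(G))=LE^+(\mathcal{B}(G))$.
   Context: $D_{2m}=\langle a,b : a^m=b^2=1,\ bab=a^{-1}\rangle$ is the dihedral group of order $2m$ (for $m=2$ it is the group of order $4$ given by this presentation). For a finite group $G$, let $L(G)$ be the set of all subgroups of $G$. The subgroup generating bipartite graph $\mathcal{B}(G)$ is the simple bipartite graph with vertex set the disjoint union of $G\times G$ and $L(G)$, in which $(a,b)\in G\times G$ and $H\in L(G)$ are adjacent if and only if $H$ is the subgroup generated by $a$ and $b$ (and there are no other edges). For a finite simple graph $\Gamma$ with $n$ vertices and $m$ edges, let $A$ be its adjacency matrix and $D$ its diagonal degree matrix. The energy $E(\Gamma)$ is the sum of absolute values of the eigenvalues of $A$. The Laplacian energy is $LE(\Gamma)=\sum_{\lambda}|\lambda-\frac{2m}{n}|$ over the eigenvalues $\lambda$ of $D-A$, and the signless Laplacian energy is $LE^+(\Gamma)=\sum_{\mu}|\mu-\frac{2m}{n}|$ over the eigenvalues $\mu$ of $D+A$ (all counted with multiplicity). *)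

(* Defs.v *)
From HB Require Import structures.
From mathcomp Require Import all_boot all_order all_fingroup all_algebra.
From mathcomp Require Import all_solvable all_field.

Set Implicit Arguments.
Unset Strict Implicit.
Unset Printing Implicit Defensive.

Import Order.TTheory GRing.Theory Num.Theory.
Local Open Scope ring_scope.

Record sgraph := SGraph {
  vertex :> finType;
  adj : rel vertex;
  adj_sym : symmetric adj;
  adj_irr : irreflexive adj }.

Section Energies.

Variable Gamma : sgraph.

Definition edges : {set {set Gamma}} :=
  [set [set e.1; e.2] | e : Gamma * Gamma & adj e.1 e.2].

Definition degree (x : Gamma) : nat := #|[set y | adj x y]|.

(* Rows and columns are indexed by the vertices through enum_val.  The entries
   are integers, so the eigenvalues are algebraic numbers and algC contains all
   of them. *)
Definition adjmx : 'M[algC]_#|Gamma| :=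
  \matrix_(i, j) (adj (enum_val i) (enum_val j))%:R.

Definition degmx : 'M[algC]_#|Gamma| :=
  diag_mx (\row_i (degree (enum_val i))%:R).

(* The roots of the (monic) characteristic polynomial, with multiplicity; the
   defining property is eigenvaluesP below. *)
Definition eigenvalues n (A : 'M[algC]_n) : seq algC :=
  sval (closed_field_poly_normal (char_poly A)).

Lemma eigenvaluesP n (A : 'M[algC]_n) :
  char_poly A = \prod_(z <- eigenvalues A) ('X - z%:P).
Proof.
rewrite /eigenvalues; case: closed_field_poly_normal => r /= {1}->.
by rewrite (monicP (char_poly_monic A)) scale1r.
Qed.

Definition avg_degree : algC := (2 * #|edges|)%N%:R / #|Gamma|%:R.

(* On algC, `|z| is the complex modulus, and x < y means that y - x is a
   positive real. *)
Definition energy : algC := \sum_(z <- eigenvalues adjmx) `|z|.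

Definition laplacian_energy : algC :=
  \sum_(z <- eigenvalues (degmx - adjmx)) `|z - avg_degree|.

Definition signless_laplacian_energy : algC :=
  \sum_(z <- eigenvalues (degmx + adjmx)) `|z - avg_degree|.

End Energies.

Section SubgroupGeneratingBipartiteGraph.

Variable gT : finGroupType.

(* {group gT} is the finite type of all subgroups of gT. *)
Definition sgb_vertex : finType := ((gT * gT) + {group gT})%type.

Definition sgb_adj : rel sgb_vertex := fun u v =>
  match u, v with
  | inl ab, inr H | inr H, inl ab => H :==: <<[set ab.1; ab.2]>>%g
  | _, _ => false
  end.

Lemma sgb_adj_sym : symmetric sgb_adj.
Proof. by case=> [?|?] [?|?]. Qed.

Lemma sgb_adj_irr : irreflexive sgb_adj.
Proof. by case. Qed.

Definition sgb_graph : sgraph := SGraph sgb_adj_sym sgb_adj_irr.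

End SubgroupGeneratingBipartiteGraph.

(* Stated for an arbitrary group rather than for the concrete type 'D_(2 * m);
   the next lemma relates the two. *)
Definition is_dihedral (m : nat) (gT : finGroupType) (G : {set gT}) : Prop :=
  (G \isog Grp (a : b : a ^+ m = b ^+ 2 = 1, b * a * b = a^-1))%g.

Lemma is_dihedralD m : (1 < m)%N -> is_dihedral m [set: 'D_(2 * m)].
Proof.
move=> m1 rT H; rewrite mul2n (Grp_dihedral m1 H).
have invol (y : rT) : (y ^+ 2 = 1 -> y^-1 = y)%g.
  by move=> y2; apply/eqP; rewrite eq_invg_mul -y2.
apply/existsP/existsP=> -[[x y]] /= /eqP[defH xm y2 rel]; exists (x, y).
  by rewrite /= !xpair_eqE defH xm y2 -rel conjgE invol // mulgA !eqxx.
by rewrite /= !xpair_eqE defH xm y2 -rel conjgE invol // mulgA !eqxx.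
Qed.

(* Main.v *)
Require Import Defs.
From HB Require Import structures.
From mathcomp Require Import all_boot all_order all_fingroup all_algebra.
From mathcomp Require Import all_solvable all_field.
From mathcomp Require Import ring.

Set Implicit Arguments.
Unset Strict Implicit.
Unset Printing Implicit Defensive.

Import Order.TTheory GRing.Theory Num.Theory.
Local Open Scope ring_scope.

(** Each pair of elements generates exactly one subgroup, so the graph is a
    disjoint union of stars: the centres are the subgroups H, and the leaves of
    the star at H are the n_H pairs that generate H (possibly none).  A star
    with n > 0 leaves has adjacency eigenvalues sqrt n, - sqrt n and n - 1 times
    0, and both of its Laplacian matrices have eigenvalues 0, n + 1 and n - 1
    times 1.  The sign in front of A does not matter because only its square
    enters the spectrum, whence LE = LE+.

    With d the average degree, the star at H contributes 2 sqrt n_H to E and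
    (n_H - 1) |1 - d| + |0 - d| + |n_H + 1 - d| to LE.  If n_H > 0, then the
    triangle inequality and AM-GM give
    |0 - d| + |n_H + 1 - d| >= n_H + 1 >= 2 sqrt n_H, with strict inequality as
    soon as n_H > 1; if n_H = 0, the contribution to LE is d >= 0.  A nontrivial
    cyclic subgroup <x> is generated by both (x, x) and (x, 1), so some n_H
    exceeds 1.  The dihedral presentation enters through the nontriviality of
    the group.

    The spectra come from a Schur complement ([det_schur], [char_poly_star_mx]),
    which handles all stars and all three matrices at once; the comparison of
    the contributions is [star_contribution_le] and [star_contribution_lt]. *)

(** * Characteristic polynomials of star forests *)

(** Schur complement of a scalar block.  The powers of [a] clear denominators:
    multiplying on the right by the block matrix with rows (1, - B) and (0, a)
    makes the matrix block triangular, whether or not [a] is invertible. *)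
Lemma det_schur (R : comPzRingType) m n (a : R) (B : 'M_(m, n))
    (C : 'M_(n, m)) (D : 'M_n) :
  \det (block_mx a%:M B C D) * a ^+ n = a ^+ m * \det (a *: D - C *m B).
Proof.
have: block_mx a%:M B C D *m block_mx 1%:M (- B) 0 a%:M
    = block_mx a%:M 0 C (a *: D - C *m B).
  rewrite mulmx_block !mulmx1 !mulmx0 !addr0 mul_scalar_mx !mul_mx_scalar.
  by rewrite mulmxN scalerN addNr [_ + a *: D]addrC.
move/(congr1 determinant); rewrite det_mulmx det_ublock det_lblock.
by rewrite !det_scalar expr1n mul1r.
Qed.

Lemma det_reindex (R : comPzRingType) (T : finType) m n (f : 'I_m -> T)
    (g : 'I_n -> T) (F : T -> T -> R) : bijective f -> bijective g ->
  \det (\matrix_(i, j) F (f i) (f j)) = \det (\matrix_(i, j) F (g i) (g j)).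
Proof.
move=> bij_f bij_g; have eq_mn: m = n.
  by rewrite -[m]card_ord -[n]card_ord (bij_eq_card bij_f) (bij_eq_card bij_g).
case: n / eq_mn in g bij_g *; case: bij_g => h gK hK.
have inj_s: injective (h \o f).
  by apply: inj_comp; [apply: can_inj hK | apply: bij_inj].
pose s := perm inj_s; set B := \matrix_(i, j) F (g i) (g j).
have ->: \matrix_(i, j) F (f i) (f j) = perm_mx s *m B *m perm_mx s^-1.
  by rewrite -row_permE -col_permE; apply/matrixP=> i j; rewrite !mxE !permE /= !hK.
by rewrite !det_mulmx mulrAC -det_mulmx -perm_mxM mulgV perm_mx1 det1 mul1r.
Qed.

Section StarForest.

(** The map [f] sends each leaf to the centre of its star. *)
Variables (R : comNzRingType) (P L : finType) (f : P -> L).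

Definition leaf_count (H : L) := #|[set a | f a == H]|.

Lemma sum_leaf_count : (\sum_H leaf_count H = #|P|)%N.
Proof.
rewrite -sum1_card (partition_big f xpredT) //=; apply: eq_bigr => H _.
by rewrite sum1dep_card.
Qed.

(** The common shape of the adjacency, Laplacian and signless Laplacian
    matrices: [c] on the diagonal at the leaves, [w] on the diagonal at the
    centres, and [s] on the edges. *)
Definition star_entry (c s : R) (w : L -> R) (u v : P + L) : R :=
  match u, v with
  | inl a, inl b => c *+ (a == b)
  | inl a, inr H | inr H, inl a => s *+ (f a == H)
  | inr H, inr K => w H *+ (H == K)
  end.

Definition star_mx c s w : 'M[R]_#|{: P + L}| :=
  \matrix_(i, j) star_entry c s w (enum_val i) (enum_val j).

Definition leaves_first (i : 'I_(#|P| + #|L|)) : P + L :=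
  match split i with inl j => inl (enum_val j) | inr j => inr (enum_val j) end.

Lemma leaves_first_bij : bijective leaves_first.
Proof.
pose g (u : P + L) := unsplit match u with
  | inl a => inl (enum_rank a) | inr H => inr (enum_rank H) end.
exists g => [i | u]; rewrite /g /leaves_first.
  by case: split_ordP => j ->; rewrite enum_valK.
by rewrite unsplitK; case: u => x; rewrite enum_rankK.
Qed.

(** In the Schur complement of the leaf block, the product of the incidence
    matrix with its transpose is diagonal with entries [leaf_count H], because
    distinct stars share no leaf. *)
Lemma char_poly_star_mx c s w :
  char_poly (star_mx c s w) * ('X - c%:P) ^+ #|L| =
  ('X - c%:P) ^+ #|P| *
    \prod_H (('X - c%:P) * ('X - (w H)%:P) - (s ^+ 2 *+ leaf_count H)%:P).
Proof.
pose F u v : {poly R} := 'X *+ (u == v) - (star_entry c s w u v)%:P.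
have ->: char_poly (star_mx c s w)
       = \det (\matrix_(i, j) F (leaves_first i) (leaves_first j)).
  rewrite -(@det_reindex _ _ _ _ (@enum_val _ _) _ F (@enum_val_bij _)
    leaves_first_bij).
  rewrite /char_poly; congr determinant; apply/matrixP=> i j.
  by rewrite !mxE /F (inj_eq enum_val_inj).
pose B : 'M[{poly R}]_(#|P|, #|L|) :=
  \matrix_(i, j) - (s *+ (f (enum_val i) == enum_val j))%:P.
pose D : 'M[{poly R}]_#|L| := diag_mx (\row_j ('X - (w (enum_val j))%:P)).
have ->: \matrix_(i, j) F (leaves_first i) (leaves_first j)
       = block_mx ('X - c%:P)%:M B B^T D.
  apply/matrixP=> i j; rewrite !mxE /leaves_first.
  case: (split_ordP i) => i' _; rewrite mxE; case: (split_ordP j) => j' _;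
    rewrite !mxE /F /=.
  - by rewrite [inl _ == _](inj_eq enum_val_inj) !(inj_eq enum_val_inj) polyCMn -mulrnBl.
  - by rewrite sub0r.
  - by rewrite sub0r.
  - rewrite [inr _ == _](inj_eq enum_val_inj) !(inj_eq enum_val_inj).
    by rewrite polyCMn -mulrnBl.
rewrite det_schur; congr (_ * _).
pose E : 'rV[{poly R}]_#|L| := \row_j
  (('X - c%:P) * ('X - (w (enum_val j))%:P)
   - (s ^+ 2 *+ leaf_count (enum_val j))%:P).
have ->: ('X - c%:P) *: D - B^T *m B = diag_mx E.
  apply/matrixP=> i j; rewrite !mxE.
  have ->: \sum_k B^T i k * B k j =
      (s ^+ 2 *+ leaf_count (enum_val i))%:P *+ (i == j).
    under eq_bigr => k _ do rewrite !mxE mulrNN -polyCM.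
    rewrite -rmorph_sum -polyCMn; congr _%:P.
    rewrite -(big_enum_val (A := predT)
      (fun a => s *+ (f a == enum_val i) * (s *+ (f a == enum_val j)))) /=.
    have [-> | ne_ij] := eqVneq i j.
      rewrite mulr1n /leaf_count -sum1dep_card -sumrMnr [RHS]big_mkcond /=.
      by apply: eq_big => // a _; case: (f a == _); rewrite ?mulr1n ?mulr0n ?mul0r.
    rewrite big1 // => a _; have [-> | _] := eqVneq (f a) (enum_val i).
      by rewrite (inj_eq enum_val_inj) (negPf ne_ij) mulr0.
    by rewrite mul0r.
  by case: (i == j); rewrite ?mulr1n // !mulr0n mulr0 subr0.
rewrite det_diag [RHS](reindex _ (onW_bij _ (@enum_val_bij L))) /=.
by apply: eq_bigr => j _; rewrite mxE.
Qed.

End StarForest.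

(** * Sums over the spectrum *)

Lemma prod_XsubC_nseq (R : comNzRingType) n (c : R) :
  \prod_(z <- nseq n c) ('X - z%:P) = ('X - c%:P) ^+ n.
Proof. by rewrite big_nseq -Monoid.iteropE. Qed.

(** Each quadratic factor of [char_poly_star_mx] has the roots [u H] and [v H].
    The remaining eigenvalue [c] has multiplicity [#|P| - #|L|] in total, which
    may be negative; putting the two parts on opposite sides avoids the
    subtraction. *)
Lemma star_mx_eigenvalue_sum (P L : finType) (f : P -> L) c s w
    (u v : L -> algC) (g : algC -> algC) :
    (forall H, u H + v H = c + w H) ->
    (forall H, u H * v H = c * w H - s ^+ 2 *+ leaf_count f H) ->
  \sum_(z <- eigenvalues (star_mx f c s w)) g z + g c *+ #|L| =
  g c *+ #|P| + \sum_H (g (u H) + g (v H)).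
Proof.
move=> sum_uv prod_uv; pose uv := [seq u H | H : L] ++ [seq v H | H : L].
have: perm_eq (eigenvalues (star_mx f c s w) ++ nseq #|L| c)
              (nseq #|P| c ++ uv).
  apply: prod_XsubC_eq; rewrite !big_cat -eigenvaluesP /= !prod_XsubC_nseq.
  rewrite char_poly_star_mx !big_image -big_split /=; congr (_ * _).
  apply: eq_bigr => H _.
  have sumX: (v H)%:P = c%:P + (w H)%:P - (u H)%:P.
    by rewrite -polyCD -sum_uv polyCD addrC addKr.
  have prodX: (s ^+ 2 *+ leaf_count f H)%:P
            = c%:P * (w H)%:P - (u H)%:P * (v H)%:P.
    by rewrite -!polyCM -polyCB prod_uv subKr.
  by rewrite prodX sumX; ring.
move=> perm_spec; have sum_nseq n z: \sum_(x <- nseq n z) g x = g z *+ n.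
  by rewrite big_nseq iter_addr_0.
rewrite -!sum_nseq -big_cat (perm_big _ perm_spec) !big_cat /=.
by rewrite !big_image -big_split.
Qed.

(** * Comparing the contributions of one star *)

Lemma sqrtC_AGM (n : nat) :
  2 * sqrtC (n%:R : algC) <= n%:R + 1 ?= iff (n == 1%N).
Proof.
have sn_ge0: 0 <= sqrtC (n%:R : algC) by rewrite sqrtC_ge0 ler0n.
have sn_real: sqrtC (n%:R : algC) - 1 \is Num.real by rewrite rpredB ?ger0_real.
have sqE: n%:R + 1 - 2 * sqrtC n%:R = (sqrtC n%:R - 1) ^+ 2 :> algC.
  by rewrite -[X in X + 1 - _]sqrtCK; ring.
split; first by rewrite -subr_ge0 sqE real_exprn_even_ge0.
rewrite eq_sym -subr_eq0 sqE expf_eq0 /= subr_eq0.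
apply/eqP/eqP=> [sn1 | ->]; last by rewrite sqrtC1.
by apply/eqP; rewrite -(eqr_nat algC) -[n%:R]sqrtCK sn1 expr1n.
Qed.

Lemma star_laplacian_ge (d : algC) n : n%:R + 1 <= `|0 - d| + `|n%:R + 1 - d|.
Proof.
rewrite distrC subr0 [leRHS]addrC (le_trans _ (ler_normD _ _)) // subrK.
by rewrite real_ler_norm // rpredD ?rpred1 ?realn.
Qed.

(** The summand [`|1 - d|] on the left stands for the share of the centre in the
    term [g c *+ #|L|] of [star_mx_eigenvalue_sum]. *)
Lemma star_contribution_le (d : algC) n :
  2 * sqrtC n%:R + `|1 - d| <= `|1 - d| *+ n + (`|0 - d| + `|n%:R + 1 - d|).
Proof.
case: n => [|n].
  by rewrite sqrtC0 mulr0 mulr0n !add0r ler_wpDl.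
rewrite addrC lerD ?(le_trans (sqrtC_AGM _)) ?star_laplacian_ge //.
by rewrite mulrS lerDl mulrn_wge0.
Qed.

Lemma star_contribution_lt (d : algC) n : (1 < n)%N ->
  2 * sqrtC n%:R + `|1 - d| < `|1 - d| *+ n + (`|0 - d| + `|n%:R + 1 - d|).
Proof.
case: n => [|[|n]] // _; rewrite addrC ler_ltD //.
  by rewrite mulrS lerDl mulrn_wge0.
apply: lt_le_trans (star_laplacian_ge d _).
by rewrite (lt_leif (sqrtC_AGM _)).
Qed.

(** * The subgroup generating bipartite graph *)

Section SubgroupGeneratingStars.

Variable gT : finGroupType.

Definition gen_pair (ab : gT * gT) : {group gT} := <<[set ab.1; ab.2]>>%G.

Lemma sgb_adj_gen_pair ab (H : {group gT}) :
  (H :==: <<[set ab.1; ab.2]>>)%g = (gen_pair ab == H).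
Proof. by rewrite eq_sym. Qed.

Lemma degree_leaf ab : degree (inl ab : sgb_graph gT) = 1%N.
Proof.
rewrite /degree -(cards1 (inr (gen_pair ab) : sgb_graph gT)).
by apply: eq_card => -[cd | H]; rewrite !inE.
Qed.

Lemma degree_centre H : degree (inr H : sgb_graph gT) = leaf_count gen_pair H.
Proof.
rewrite /degree /leaf_count -[RHS](card_imset _ (@inl_inj _ {group gT})).
apply: eq_card => -[ab | K]; rewrite !inE /=.
  by rewrite (mem_imset _ _ inl_inj) inE sgb_adj_gen_pair.
by apply/esym/imsetP=> -[].
Qed.

Lemma adjmx_star : adjmx (sgb_graph gT) = star_mx gen_pair 0 1 (fun=> 0).
Proof.
apply/matrixP=> i j; rewrite !mxE /=.
by case: (enum_val i) => u; case: (enum_val j) => v /=;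
  rewrite ?mul0rn // sgb_adj_gen_pair.
Qed.

(** Both Laplacian matrices at once, according to the sign [s]. *)
Lemma laplacian_star (s : algC) :
  degmx (sgb_graph gT) + s *: adjmx (sgb_graph gT) =
  star_mx gen_pair 1 s (fun H => (leaf_count gen_pair H)%:R).
Proof.
apply/matrixP=> i j; rewrite !mxE -(inj_eq enum_val_inj) /=.
case: (enum_val i) => u; case: (enum_val j) => v /=;
  rewrite ?mulr0n ?mulr0 ?addr0 ?add0r.
- by rewrite degree_leaf.
- by rewrite sgb_adj_gen_pair mulr_natr.
- by rewrite sgb_adj_gen_pair mulr_natr.
- by rewrite degree_centre.
Qed.

Lemma energy_sgb :
  energy (sgb_graph gT) = \sum_H 2 * sqrtC (leaf_count gen_pair H)%:R.
Proof.
have := @star_mx_eigenvalue_sum _ _ gen_pair 0 1 (fun=> 0)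
  (fun H => sqrtC (leaf_count gen_pair H)%:R)
  (fun H => - sqrtC (leaf_count gen_pair H)%:R) Num.norm.
rewrite /energy adjmx_star normr0 !mul0rn !addr0 !add0r => ->.
- apply: eq_bigr => H _.
  by rewrite normrN ger0_norm ?sqrtC_ge0 ?ler0n // mulr_natl mulr2n.
- by move=> H; rewrite subrr.
- by move=> H; rewrite mulrN -expr2 sqrtCK mul0r expr1n sub0r.
Qed.

Lemma laplacian_sum_sgb (s d : algC) : s ^+ 2 = 1 ->
  let Q := degmx (sgb_graph gT) + s *: adjmx (sgb_graph gT) in
  \sum_(z <- eigenvalues Q) `|z - d| + `|1 - d| *+ #|{group gT}| =
  \sum_H (`|1 - d| *+ leaf_count gen_pair H +
          (`|0 - d| + `|(leaf_count gen_pair H)%:R + 1 - d|)).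
Proof.
move=> s2 /=; rewrite laplacian_star.
have := @star_mx_eigenvalue_sum _ _ gen_pair 1 s
  (fun H => (leaf_count gen_pair H)%:R) (fun=> 0)
  (fun H => (leaf_count gen_pair H)%:R + 1) (fun z => `|z - d|).
move=> ->.
- by rewrite [RHS]big_split /= sumrMnr sum_leaf_count.
- by move=> H; rewrite add0r addrC.
- by move=> H; rewrite s2 mul0r mul1r subrr.
Qed.

Lemma laplacian_signless_eq :
  laplacian_energy (sgb_graph gT) = signless_laplacian_energy (sgb_graph gT).
Proof.
have sqrN1 : (-1 : algC) ^+ 2 = 1 by rewrite sqrrN expr1n.
have := etrans (laplacian_sum_sgb (avg_degree (sgb_graph gT)) sqrN1)
               (esym (laplacian_sum_sgb _ (expr1n _ 2))).
by rewrite /= scaleN1r scale1r => /addIr.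
Qed.

(** Both (x, x) and (x, 1) generate the cyclic group of x. *)
Lemma leaf_count_cycle_gt1 (x : gT) : x != 1%g ->
  (1 < leaf_count gen_pair <[x]>%G)%N.
Proof.
move=> ntx; have <-: #|[set (x, x); (x, 1%g)]| = 2%N.
  by rewrite cards2 xpair_eqE eqxx ntx.
apply/subset_leq_card/subsetP=> ab; rewrite !inE => /orP[] /eqP-> /=;
  rewrite -val_eqE /=.
  by rewrite setUid.
by rewrite -genD1id setDUl setDv setU0 genD1id.
Qed.

Lemma energy_lt_laplacian : [set: gT] != 1%g ->
  energy (sgb_graph gT) < laplacian_energy (sgb_graph gT).
Proof.
case/trivgPn=> x _ ntx; pose d := avg_degree (sgb_graph gT).
have := @laplacian_sum_sgb (-1) d; rewrite scaleN1r sqrrN expr1n => /(_ erefl) LE.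
rewrite -(ltrD2r (`|1 - d| *+ #|{group gT}|)) [ltRHS]LE energy_sgb.
rewrite -sumr_const -big_split /= (bigD1 <[x]>%G) //= [ltRHS](bigD1 <[x]>%G) //=.
apply: ltr_leD; first exact/star_contribution_lt/leaf_count_cycle_gt1.
by apply: ler_sum => H _; apply: star_contribution_le.
Qed.

End SubgroupGeneratingStars.

(** The concrete dihedral group satisfies the same presentation, so it is a
    quotient of any group with that presentation. *)
Lemma dihedral_nontrivial m (gT : finGroupType) : (1 < m)%N ->
  is_dihedral m [set: gT] -> [set: gT] != 1%g.
Proof.
move=> m_gt1 dihG; apply/eqP=> G1.
have := isoGrp_hom (is_dihedralD m_gt1); rewrite -dihG => /card_homg.
rewrite mul2n card_dihedral //= [in #|_|]G1 cards1 dvdn1 => /eqP.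
by case: m m_gt1 {dihG} => [|[|]].
Qed.

Theorem theorem3p7 (p : nat) (gT : finGroupType) (p_pr : prime p)
  (dihG : is_dihedral p [set: gT] \/ is_dihedral (p ^ 2) [set: gT]) :
  energy (sgb_graph gT) < laplacian_energy (sgb_graph gT) /\
  laplacian_energy (sgb_graph gT) = signless_laplacian_energy (sgb_graph gT).
Proof.
have p_gt1 := prime_gt1 p_pr.
split; last exact: laplacian_signless_eq.
apply: energy_lt_laplacian; case: dihG; apply: dihedral_nontrivial => //.
by rewrite (leq_trans p_gt1) // -{1}(expn1 p) leq_exp2l.
Qed.
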